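(* Let $\sigma_j=1/\log_2(j+1)$, $j\ge1$, and $\mathcal{K}(\sigma)=\{\sigma_je_j\}_{j=1}^\infty\cup\{0\}\subset c_0$. Then $\tilde\varepsilon_n(\mathcal{K}(\sigma))_{c_0}\asymp\frac1n$ for $n\ge1$, and for every $\gamma>2$, $d_n^\gamma(\mathcal{K}(\sigma))_{c_0}\asymp\frac{1}{n\log_2(n+1)}$ for $n\ge1$.
   Context: $c_0$ denotes the Banach space of real sequences converging to $0$ with the norm $\|x\|=\sup_j|x_j|$, and $(e_j)$ is its standard unit vector basis. $a_n\asymp b_n$ means there are constants $0<c\le C$ independent of $n$ (possibly depending on $\gamma$) with $cb_n\le a_n\le Cb_n$. The inner entropy number $\tilde\varepsilon_n(\mathcal{K})_{c_0}$ is the infimum of all $\varepsilon>0$ such that $\mathcal{K}$ is covered by $2^n$ closed balls of radius $\varepsilon$ with centers in $\mathcal{K}$. For $k\ge1$ and a norm $\|\cdot\|_{Y_k}$ on $\mathbb{R}^k$ let $B_{Y_k}=\{y\in\mathbb{R}^k:\|y\|_{Y_k}\le1\}$; $d^\gamma(\mathcal{K},Y_k)_{c_0}=\inf_{\Phi}\sup_{f\in\mathcal{K}}\inf_{y\in B_{Y_k}}\|f-\Phi(y)\|$, the infimum over all maps $\Phi:B_{Y_k}\to c_0$ with $\|\Phi(y)-\Phi(y')\|\le\gamma\|y-y'\|_{Y_k}$; and $d_n^\gamma(\mathcal{K})_{c_0}=\inf_{1\le k\le n}\inf_{\|\cdot\|_{Y_k}}d^\gamma(\mathcal{K},Y_k)_{c_0}$,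 the inner infimum over all norms on $\mathbb{R}^k$. *)

(* Defs.v *)
From HB Require Import structures.
From mathcomp Require Import all_boot all_order all_algebra.
From mathcomp Require Import all_classical all_reals all_analysis.
Set Implicit Arguments. Unset Strict Implicit. Unset Printing Implicit Defensive.
Import Order.TTheory GRing.Theory Num.Theory.
Import numFieldNormedType.Exports.
Local Open Scope classical_set_scope.
Local Open Scope ring_scope.

Section Defs.
Variable R : realType.

(* Elements of c_0: real sequences (coordinate i : nat stands for the paper's
   index j = i+1) converging to 0. *)
Definition is_c0 (x : nat -> R) : Prop := x @ \oo --> (0 : R).

Definition c0dist (x y : nat -> R) : R := sup (range (fun i => `|x i - y i|)).

Definition unitv (i : nat) : nat -> R := fun m => if m == i then 1 else 0.

Definition inner_entropy (K : set (nat -> R)) (n : nat) : R :=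
  inf [set e : R | 0 < e /\
         exists c : 'I_(2 ^ n) -> (nat -> R),
           (forall i, K (c i)) /\
           (forall f, K f -> exists i, c0dist f (c i) <= e)].

Definition is_norm (k : nat) (N : 'rV[R]_k -> R) : Prop :=
  [/\ forall x, N x = 0 -> x = 0,
      forall (a : R) x, N (a *: x) = `|a| * N x &
      forall x y, N (x + y) <= N x + N y].

Definition lip_map (k : nat) (N : 'rV[R]_k -> R) (gamma : R)
    (Phi : 'rV[R]_k -> (nat -> R)) : Prop :=
  (forall y, N y <= 1 -> is_c0 (Phi y)) /\
  (forall y y', N y <= 1 -> N y' <= 1 ->
     c0dist (Phi y) (Phi y') <= gamma * N (y - y')).

Definition lip_width_Y (K : set (nat -> R)) (k : nat) (N : 'rV[R]_k -> R)
    (gamma : R) : R :=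
  inf [set s : R | exists Phi, lip_map N gamma Phi /\
         s = sup [set t : R | exists2 f, K f &
                t = inf [set u : R | exists2 y, N y <= 1 & u = c0dist f (Phi y)]]].

Definition lip_width (K : set (nat -> R)) (n : nat) (gamma : R) : R :=
  inf [set s : R | exists k : nat, (1 <= k <= n)%N /\
         exists N : 'rV[R]_k -> R, is_norm N /\ s = lip_width_Y K N gamma].

Definition log2 (x : R) : R := ln x / ln 2.

(* sigma_j = 1/log2(j+1), j >= 1; at coordinate i (j = i+1) this is 1/log2(i+2) *)
Definition sigma_c (i : nat) : R := 1 / log2 (i.+2)%:R.

Definition Ksigma : set (nat -> R) :=
  [set x | x = (fun _ => 0) \/ exists i : nat, x = (fun m => sigma_c i * unitv i m)].

Definition asymp (a b : nat -> R) : Prop :=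
  exists c C : R, 0 < c /\ c <= C /\
    forall n : nat, (1 <= n)%N -> c * b n <= a n /\ a n <= C * b n.

End Defs.

(* Main.v *)
(* The points sigma_j e_j satisfy |sigma_i e_i - sigma_j e_j| = max(sigma_i, sigma_j), so
   covering K by 2^n balls costs about sigma_(2^n), which is about 1/n.

   Lower bound for the width: if Phi approximates the first 2^(M-1) points up to 1/(4M),
   their approximate preimages are 1/(2 M gamma)-separated in the unit ball of a norm on R^k.
   For any norm, a crude packing count (C M n)^n suffices, and it comes from
   a maximal-determinant (Auerbach-like) basis; it is smaller than 2^(M-1) once M is a large
   multiple of n log n.

   Upper bound: in the sup norm on R^n, pick nodes y_i in the unit ball with
   |y_i - y_j| >= max(sigma_i, sigma_j)/gamma for all i, j up to 2^(c n log n). The map whose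
   i-th coordinate is the positive part of sigma_i - gamma |y - y_i| is gamma-Lipschitz into
   c_0, sends y_i to sigma_i e_i, and vanishes far from all nodes. *)

Require Import Defs.
From HB Require Import structures.
From mathcomp Require Import all_boot all_order all_algebra.
From mathcomp Require Import all_classical all_reals all_analysis.
From mathcomp Require Import zify ring lra.
Set Implicit Arguments. Unset Strict Implicit. Unset Printing Implicit Defensive.
Import Order.TTheory GRing.Theory Num.Theory.
Import numFieldNormedType.Exports.
Local Open Scope ring_scope.

(** * Determinants and packing in the unit ball of an arbitrary norm *)

(** Cramer's rule: a coordinate in the basis is a ratio of two determinants, the numerator having
    one basis row replaced by [v i]. For a choice of maximal absolute determinant no ratio exceeds 1
    in absolute value. *)
Lemma max_det_coords (R : realFieldType) (k : nat) (I : finType) (v : I -> 'rV[R]_k)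
    (f0 : {ffun 'I_k -> I}) :
  \det (\matrix_l v (f0 l)) != 0 ->
  exists f : {ffun 'I_k -> I}, forall i, exists2 c : 'rV[R]_k,
    v i = \sum_l c ord0 l *: v (f l) & forall l, `|c ord0 l| <= 1.
Proof.
move=> det0; pose D (f : {ffun 'I_k -> I}) := `|\det (\matrix_l v (f l))|.
have [f _ fmax] := @Order.TotalTheory.arg_maxP _ _ _ f0 xpredT D isT.
have Df_gt0 : 0 < D f by apply: lt_le_trans (fmax f0 isT); rewrite normr_gt0.
pose M : 'M[R]_k := \matrix_l v (f l).
have M_neq0 : \det M != 0 by rewrite -normr_gt0.
exists f => i; exists ((\det M)^-1 *: (v i *m \adj M)) => [|l].
  have {1}-> : v i = ((\det M)^-1 *: (v i *m \adj M)) *m M.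
    by rewrite -scalemxAl -mulmxA mul_adj_mx mul_mx_scalar scalerA mulVf ?scale1r.
  by rewrite mulmx_sum_row; apply: eq_bigr => l _; rewrite rowK.
have -> : (v i *m \adj M) = \row_l \det (\matrix_j v (finfun (fun j => if j == l then i else f j) j)).
  apply/rowP => l'; rewrite !mxE (expand_det_row _ l'); apply: eq_bigr => j _.
  rewrite !mxE ffunE eqxx; congr (_ * _).
  rewrite /cofactor; congr (_ * \det _).
  by apply/matrixP => a b; rewrite !mxE ffunE eq_sym (negbTE (neq_lift _ _)).
rewrite !mxE normrM normfV mulrC ler_pdivrMr // mul1r.
exact: (fmax [ffun j => if j == l then i else f j] isT).
Qed.

Section Norm.
Variables (R : realType) (k : nat) (N : 'rV[R]_k -> R).
Hypothesis normN : is_norm N.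

Lemma is_norm0 : N 0 = 0.
Proof. by case: normN => _ NZ _; rewrite -(scale0r (0 : 'rV_k)) NZ normr0 mul0r. Qed.

Lemma is_normN x : N (- x) = N x.
Proof. by case: normN => _ NZ _; rewrite -scaleN1r NZ normrN1 mul1r. Qed.

Lemma is_norm_ge0 x : 0 <= N x.
Proof.
case: normN => _ _ ND; have := ND x (- x).
by rewrite subrr is_norm0 is_normN => ?; lra.
Qed.

Lemma is_norm_sum (I : finType) (c : I -> R) (v : I -> 'rV[R]_k) :
  N (\sum_i c i *: v i) <= \sum_i `|c i| * N (v i).
Proof.
case: normN => _ NZ ND.
elim/big_rec2: _ => [|i y x _ le_xy]; first by rewrite is_norm0.
by apply: le_trans (ND _ _) _; rewrite NZ lerD2l.
Qed.

(* Among the [J] points and suitable multiples of the coordinate vectors, [k]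
   vectors of maximal determinant form a basis in which all points have
   coordinates in [-1, 1], whatever the norm; separation then survives rounding
   the coordinates to a grid of mesh [1/m]. *)
Lemma separated_ball_card (J m : nat) (delta : R) (y : 'I_J -> 'rV[R]_k) :
  (0 < m)%N -> k%:R < m%:R * delta ->
  (forall i, N (y i) <= 1) ->
  (forall i j, i != j -> delta <= N (y i - y j)) ->
  (J <= (m.*2.+1) ^ k)%N.
Proof.
move=> m_gt0 ltkm y_le1 y_sep.
have [N_eq0 NZ ND] := normN.
have e_gt0 (l : 'I_k) : 0 < N (delta_mx ord0 l).
  rewrite lt_def is_norm_ge0 andbT; apply/negP => /eqP /N_eq0 /rowP /(_ l).
  by rewrite !mxE !eqxx => /eqP; rewrite oner_eq0.
(* The normalized coordinate vectors guarantee a choice of nonzero determinant even when the [y i]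
   do not span. *)
pose v (i : 'I_J + 'I_k) := match i with
  inl i => y i | inr l => (N (delta_mx ord0 l))^-1 *: delta_mx ord0 l end.
have v_le1 i : N (v i) <= 1.
  case: i => [i|l] /=; first exact: y_le1.
  by rewrite NZ ger0_norm ?invr_ge0 ?(ltW (e_gt0 l)) // mulVf // gt_eqF.
have [|f hf] := max_det_coords (v := v) (f0 := [ffun l => inr l]).
  have -> : \matrix_l v ([ffun l => inr l] l) =
            diag_mx (\row_l (N (delta_mx ord0 l))^-1).
    apply/matrixP => a b; rewrite !mxE ffunE /= !mxE eqxx /= eq_sym.
    by rewrite mulr_natr.
  rewrite det_diag; apply/prodf_neq0 => l _.
  by rewrite mxE invr_eq0 gt_eqF.
have /boolp.choice [c hc] (i : 'I_J) : exists c : 'rV[R]_k,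
   y i = \sum_l c ord0 l *: v (f l) /\ (forall l, `|c ord0 l| <= 1).
  by have [c ? ?] := hf (inl i); exists c.
have mR : 0 < m%:R :> R by rewrite ltr0n.
(* Shifted to [0, 2] and scaled by [m], a coordinate has integer part at most [2 m]: hence [2 m + 1]
   cells per axis. Two points in one cell are at distance at most [k / m < delta]. *)
pose q (i : 'I_J) : {ffun 'I_k -> 'I_(m.*2.+1)} :=
  [ffun l => inord (Num.truncn ((c i ord0 l + 1) * m%:R))].
have q_inj : injective q.
  move=> i j eq_q; apply/eqP/negPn/negP => neq_ij.
  have := y_sep _ _ neq_ij; apply/negP; rewrite -ltNge.
  have [[yi ci] [yj cj]] := (hc i, hc j).
  have -> : y i - y j = \sum_l (c i ord0 l - c j ord0 l) *: v (f l).
    by rewrite yi yj -sumrB; apply: eq_bigr => l _; rewrite scalerBl.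
  have -> : delta = (m%:R * delta) / m%:R by rewrite mulrC mulKf ?gt_eqF.
  apply: le_lt_trans (_ : k%:R / m%:R < _); last by rewrite ltr_pM2r ?invr_gt0.
  apply: le_trans (is_norm_sum _ _) _.
  have -> : k%:R / m%:R = \sum_(l < k) m%:R^-1 :> R.
    by rewrite sumr_const card_ord mulr_natl.
  apply: ler_sum => l _.
  apply: le_trans (_ : `|c i ord0 l - c j ord0 l| * 1 <= _).
    by apply: ler_wpM2l.
  rewrite mulr1.
  have bnd (i' : 'I_J) : 0 <= (c i' ord0 l + 1) * m%:R <= m.*2%:R.
    have [_ /(_ l)] := hc i'; rewrite ler_norml => /andP[c1 c2].
    by rewrite -mul2n natrM; apply/andP; split; [apply: mulr_ge0; lra | apply: ler_wpM2r; lra].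
  have tr (i' : 'I_J) : (Num.truncn ((c i' ord0 l + 1) * m%:R) <= m.*2)%N.
    have /andP[b0 b1] := bnd i'.
    by rewrite -(natrK (R := R) m.*2); apply: le_truncn.
  have /(congr1 val) := congr1 (fun g : {ffun _ -> _} => g l) eq_q.
  rewrite !ffunE /= !inordK ?ltnS ?tr // => eq_tr.
  have /andP[bi _] := bnd i; have /andP[bj _] := bnd j.
  have /andP[i1 i2] := truncn_itv bi; have /andP[j1 j2] := truncn_itv bj.
  rewrite -[leRHS]mul1r ler_pdivlMr // -[m%:R in leLHS]ger0_norm ?ltW // -normrM.
  move: i1 i2 j1 j2; rewrite eq_tr -natr1 => i1 i2 j1 j2.
  by rewrite ltr_norml; apply/andP; split; lra.
by have := leq_card q q_inj; rewrite card_ord card_ffun !card_ord.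
Qed.
End Norm.

(** * The sup distance on bounded sequences *)

Section C0dist.
Variable R : realType.
Implicit Types x y : nat -> R.

Definition bounded_seq x := exists C, forall i, `|x i| <= C.

Lemma is_c0_bounded x : is_c0 x -> bounded_seq x.
Proof.
move=> xc; have [C [_ hC]] := cvg_seq_bounded (cvgP _ xc).
by exists (C + 1) => i; apply: (hC (C + 1) _ i I); rewrite ltrDl.
Qed.

(** Boundedness makes the supremum genuine: on an unbounded set [sup] takes the default value 0. *)
Lemma c0dist_ge x y i : bounded_seq x -> bounded_seq y -> `|x i - y i| <= c0dist x y.
Proof.
move=> [C xC] [D yD]; apply: ub_le_sup; last by exists i.
exists (C + D) => _ [j _ <-].
by apply: le_trans (ler_normB _ _) _; apply: lerD.
Qed.

Lemma c0dist_le x y e : (forall i, `|x i - y i| <= e) -> c0dist x y <= e.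
Proof.
move=> h; apply: ge_sup; first by exists `|x 0%N - y 0%N|, 0%N.
by move=> _ [i _ <-].
Qed.

Lemma c0dist_ge0 x y : bounded_seq x -> bounded_seq y -> 0 <= c0dist x y.
Proof. by move=> bx bz; apply: le_trans (c0dist_ge 0%N bx bz). Qed.

End C0dist.

(** * The weights, the peaks and the inner entropy numbers *)

Section Sigma.
Variable R : realType.

Lemma ln2_gt0 : 0 < ln 2 :> R.
Proof. by rewrite ln_gt0 // ltr1n. Qed.

Lemma ler_log2 (x y : R) : 0 < x -> x <= y -> log2 x <= log2 y.
Proof.
move=> x0 xy; rewrite ler_pM2r ?invr_gt0 ?ln2_gt0 //.
by rewrite ler_ln ?posrE // (lt_le_trans x0).
Qed.

Lemma log2_exp (m : nat) : log2 (2 ^+ m) = m%:R :> R.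
Proof. by rewrite /log2 lnXn // -[_ *+ m]mulr_natl mulfK // gt_eqF // ln2_gt0. Qed.

Lemma log2_ge (m n : nat) : (2 ^ m <= n)%N -> m%:R <= log2 n%:R :> R.
Proof.
by move=> h; rewrite -(log2_exp m); apply: ler_log2; rewrite ?exprn_gt0 // -natrX ler_nat.
Qed.

Lemma log2_le (m n : nat) : (0 < n <= 2 ^ m)%N -> log2 n%:R <= m%:R :> R.
Proof.
by move=> /andP[n0 h]; rewrite -(log2_exp m); apply: ler_log2; rewrite ?ltr0n // -natrX ler_nat.
Qed.

Lemma sigma_ge (m i : nat) : (i.+2 <= 2 ^ m)%N -> m%:R^-1 <= sigma_c R i.
Proof.
move=> h; rewrite /sigma_c div1r lef_pV2 ?posrE; first exact: log2_le.
  by rewrite ltr0n; case: m h.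
by apply: lt_le_trans (@log2_ge 1 _ _).
Qed.

Lemma sigma_le (m i : nat) : (0 < m)%N -> (2 ^ m <= i.+2)%N -> sigma_c R i <= m%:R^-1.
Proof.
move=> m0 h; rewrite /sigma_c div1r lef_pV2 ?posrE ?ltr0n //; first exact: log2_ge.
by apply: lt_le_trans (@log2_ge 1 _ _).
Qed.

Lemma sigma_gt0 i : 0 < sigma_c R i.
Proof.
apply: lt_le_trans (@sigma_ge i.+2 _ _); first by rewrite invr_gt0 ltr0n.
exact/ltnW/ltn_expl.
Qed.

Lemma sigma_le1 i : sigma_c R i <= 1.
Proof. by rewrite -[leRHS]invr1; apply: (@sigma_le 1). Qed.

Lemma sigma_c0 : is_c0 (sigma_c R).
Proof.
apply/cvgrPdist_lt => e e0.
have [m me] : exists m : nat, e^-1 < m%:R.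
  by exists (Num.truncn e^-1).+1; exact: truncnS_gt.
have m0 : 0 < m%:R :> R by apply: lt_trans me; rewrite invr_gt0.
exists (2 ^ m)%N => // i /= hi.
rewrite sub0r normrN gtr0_norm ?sigma_gt0 //.
apply: le_lt_trans (@sigma_le m i _ _) _; first by rewrite -(ltr0n R).
  by apply: leq_trans hi _; rewrite -addn2 leq_addr.
by rewrite invf_plt ?posrE.
Qed.

Definition peak (i : nat) : nat -> R := fun m => sigma_c R i * unitv R i m.

Lemma peakE i m : peak i m = if m == i then sigma_c R i else 0.
Proof. by rewrite /peak /unitv; case: eqP; rewrite ?mulr1 ?mulr0. Qed.

Lemma Ksigma_peak i : Ksigma (peak i).
Proof. by right; exists i. Qed.

Lemma Ksigma_le1 f i : @Ksigma R f -> `|f i| <= 1.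
Proof.
move=> [->|[j ->]]; first by rewrite normr0.
rewrite -/(peak j i) peakE; case: eqP; rewrite ?normr0 // => _.
by rewrite gtr0_norm ?sigma_gt0 // sigma_le1.
Qed.

Lemma Ksigma_bounded f : @Ksigma R f -> bounded_seq f.
Proof. by move=> Kf; exists 1 => i; exact: Ksigma_le1. Qed.

(** A center in [Ksigma] vanishes at coordinate [i] or at coordinate [j], and there it misses the
    full height of the peak. *)
Lemma Ksigma_sep (f : nat -> R) i j e : @Ksigma R f -> i != j ->
  c0dist (peak i) f <= e -> c0dist (peak j) f <= e ->
  sigma_c R i <= e \/ sigma_c R j <= e.
Proof.
move=> Kf neq_ij hi hj.
have [[bi bj] bf] := (Ksigma_bounded (Ksigma_peak i),
  Ksigma_bounded (Ksigma_peak j), Ksigma_bounded Kf).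
have {hi}hi := le_trans (c0dist_ge i bi bf) hi.
have {hj}hj := le_trans (c0dist_ge j bj bf) hj.
rewrite !peakE !eqxx in hi hj.
have gt0 l := gtr0_norm (sigma_gt0 l).
case: Kf => [f0|[l fl]].
  by left; move: hi; rewrite f0 subr0 gt0.
have [li|nli] := eqVneq l i.
  right; move: hj; rewrite fl -/(peak l j) peakE li eq_sym (negbTE neq_ij).
  by rewrite subr0 gt0.
left; move: hi; rewrite fl -/(peak l i) peakE eq_sym (negbTE nli).
by rewrite subr0 gt0.
Qed.

Lemma inner_entropy_le n : (1 <= n)%N -> inner_entropy (@Ksigma R) n <= 1 / n%:R.
Proof.
move=> n1; have n0 : 0 < n%:R :> R by rewrite ltr0n.
apply: ge_inf; first by exists 0 => e [/ltW].
split; first by rewrite divr_gt0.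
(* Index 0 is the center 0, the other [2 ^ n - 1] centers are the first peaks. A peak left out has
   [2 ^ n <= i.+1], hence height at most [1 / n]. *)
exists (fun i => if i == 0%N :> nat then fun=> 0 else peak i.-1); split=> [i|f].
  by case: ifP => _; [left | exact: Ksigma_peak].
have e_gt0 : (0 < 2 ^ n)%N by rewrite expn_gt0.
case=> [->|[i ->]].
  exists (Ordinal e_gt0) => /=; apply: c0dist_le => i.
  by rewrite subrr normr0 divr_ge0 // ltW.
have [lt_i|le_i] := ltnP i.+1 (2 ^ n).
  exists (Ordinal lt_i) => /=; apply: c0dist_le => j.
  by rewrite subrr normr0 divr_ge0 // ltW.
exists (Ordinal e_gt0) => /=; apply: c0dist_le => j.
rewrite -/(peak i j) peakE subr0; case: eqP => _; last by rewrite normr0 divr_ge0 // ltW.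
rewrite gtr0_norm ?sigma_gt0 // div1r; apply: sigma_le => //.
exact: leqW.
Qed.

(** Pigeonhole: two of the first [2 ^ n + 1] peaks share a center. *)
Lemma inner_entropy_ge n : (1 <= n)%N -> 2^-1 * (1 / n%:R) <= inner_entropy (@Ksigma R) n.
Proof.
move=> n1; have n0 : 0 < n%:R :> R by rewrite ltr0n.
apply: lb_le_inf.
  have inf_ex : exists c : 'I_(2 ^ n) -> nat -> R, (forall i, Ksigma (c i)) /\
      forall f, @Ksigma R f -> exists i, c0dist f (c i) <= 1.
    exists (fun=> fun=> 0); split=> [i|f Kf]; first by left.
    have e_gt0 : (0 < 2 ^ n)%N by rewrite expn_gt0.
    exists (Ordinal e_gt0); apply: c0dist_le => j; rewrite subr0.
    exact: Ksigma_le1.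
  by exists 1.
move=> e [e0 [c [Kc hc]]].
have /boolp.choice [g hg] (i : 'I_(2 ^ n).+1) : exists l, c0dist (peak i) (c l) <= e.
  exact: hc (Ksigma_peak i).
have [i [j [neq_ij eq_g]]] : exists i j, i != j /\ g i = g j.
  have /injectivePn[i [j ?]] : ~~ injectiveb g.
    by apply/negP => /injectiveP /leq_card; rewrite !card_ord ltnn.
  by move=> ?; exists i, j.
(* From [l + 2 <= 2 ^ (n + 1)] the height is at least [1 / (n + 1)], and [n + 1 <= 2 n] produces the
   factor [2^-1]. *)
have s_ge (l : 'I_(2 ^ n).+1) : 2^-1 * (1 / n%:R) <= sigma_c R l.
  apply: le_trans (@sigma_ge n.+1 l _).
    rewrite mul1r -invfM lef_pV2 ?posrE ?mulr_gt0 ?ltr0n //.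
    by rewrite -natrM ler_nat mul2n -addnn -addn1 leq_add2l.
  have := ltn_ord l; rewrite ltnS => l_le.
  have : (2 ^ 1 <= 2 ^ n)%N by rewrite leq_exp2l.
  by rewrite [(2 ^ n.+1)%N]expnS; lia.
have hj := hg j; rewrite -eq_g in hj.
case: (Ksigma_sep (Kc (g i)) neq_ij (hg i) hj) => h.
  exact: le_trans (s_ge i) h.
exact: le_trans (s_ge j) h.
Qed.

End Sigma.

(* With [M = A n L] and [A = 160 G]: the left-hand side bounds the number of
   grid cells, the right-hand side is the number of separated points. The
   constant [A] is chosen so that [80 A G <= 2^A]. *)
Lemma grid_count (G n L k : nat) : (0 < G)%N -> (0 < n)%N -> (n < 2 ^ L)%N -> (k <= n)%N ->
  ((2 * (160 * G * n * L) * G * n).*2.+1 ^ k < 2 ^ (160 * G * n * L).-1)%N.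
Proof.
move=> G0 n0 nL kn.
have L0 : (0 < L)%N by case: L nL => // ; rewrite expn0; lia.
set A := (160 * G)%N; set t := (80 * G)%N.
have A2t : A = (t * 2)%N by rewrite /A /t; lia.
have t_lt : (t < 2 ^ t)%N := @ltn_expl 2 t isT.
have t2_le : (t * 2 <= 2 ^ t)%N.
  have [t' tE] : exists t', t = t'.+1 by exists t.-1; rewrite prednK // /t; lia.
  by rewrite tE expnS mulnC leq_mul2l ltn_expl.
have LL := @ltn_expl 2 L isT.
have A_ge3 : (3 <= A)%N by rewrite /A; lia.
have AGle : (80 * A * G <= 2 ^ A)%N.
  rewrite [in leqRHS]A2t muln2 -addnn expnD.
  have -> : (80 * A * G = t * (t * 2))%N by rewrite -A2t /t; lia.
  by apply: leq_mul => //; exact: ltnW.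
set X := _.*2.+1.
(* One factor suffices: the power [n] turns the exponent into [(A L - 1) n <= A n L - 1]. *)
have X_lt : (X < 2 ^ (A * L).-1)%N.
  have h1 : (X <= 5 * A * G * (n * n * L))%N.
    have : (0 < A * G * n * n * L)%N by rewrite !muln_gt0 /A; lia.
    by rewrite /X; nia.
  have h2 : (n * n * L < 2 ^ (3 * L))%N.
    have -> : (3 * L = L + L + L)%N by lia.
    by rewrite !expnD; apply: ltn_mul => //; apply: ltn_mul.
  have h3 : (80 * A * G * (n * n * L) < 2 ^ A * 2 ^ (3 * L))%N.
    apply: leq_ltn_trans (leq_mul AGle (leqnn _)) _.
    by rewrite ltn_pmul2l ?expn_gt0.
  (* The exponents compare because [0 <= (A - 3) (L - 1)]. The factor [80 = 5 * 16] pays for the 5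
     in [h1] and for this [2 ^ 4]. *)
  have h4 : (2 ^ A * 2 ^ (3 * L) <= 2 ^ (A * L).-1 * 2 ^ 4)%N.
    by rewrite -!expnD leq_exp2l //; nia.
  by rewrite -(ltn_pmul2r (m := 2 ^ 4)) //; apply: leq_trans h4; apply: leq_ltn_trans h3; rewrite -[(2 ^ 4)%N]/16%N; nia.
apply: (@leq_ltn_trans (X ^ n)); first by rewrite leq_pexp2l.
apply: (@leq_trans ((2 ^ (A * L).-1) ^ n)); first by rewrite ltn_exp2r.
by rewrite -expnM leq_exp2l //; nia.
Qed.

(** * Lipschitz widths and their lower bound *)

Section LipschitzWidth.
Variable R : realType.

Definition approx_errors (k : nat) (N : 'rV[R]_k -> R) (Phi : 'rV[R]_k -> nat -> R)
    (f : nat -> R) : set R :=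
  [set u : R | exists2 y, N y <= 1 & u = c0dist f (Phi y)]%classic.

Section FixedNorm.
Variables (k : nat) (N : 'rV[R]_k -> R) (gamma : R).
Hypotheses (normN : is_norm N) (g_gt0 : 0 < gamma).

Let N0_le1 : N 0 <= 1. Proof. by rewrite (is_norm0 normN). Qed.

(** The zero map keeps the sets under the infima nonempty, where [inf] would otherwise default to 0;
    it is also the approximant in dimension 1. *)
Lemma lip_map_cst0 : lip_map N gamma (fun=> fun=> 0).
Proof.
split=> [y _|y y' _ _]; first exact: cvg_cst.
apply: c0dist_le => i; rewrite subrr normr0.
by apply: mulr_ge0; [exact: ltW | exact: is_norm_ge0].
Qed.

Variable Phi : 'rV[R]_k -> nat -> R.
Hypothesis lipPhi : lip_map N gamma Phi.

Lemma lip_map_bounded y : N y <= 1 -> bounded_seq (Phi y).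
Proof. by case: lipPhi => c0Phi _ /c0Phi /is_c0_bounded. Qed.

Lemma approx_errors_neq0 f : (approx_errors N Phi f !=set0)%classic.
Proof. by eexists; exists 0. Qed.

Lemma approx_errors_ge0 f : Ksigma f -> lbound (approx_errors N Phi f) 0.
Proof.
move=> Kf _ [y Ny ->].
by apply: c0dist_ge0; [exact: Ksigma_bounded | exact: lip_map_bounded].
Qed.

Lemma inf_approx_errors_le f y : Ksigma f -> N y <= 1 ->
  inf (approx_errors N Phi f) <= c0dist f (Phi y).
Proof.
move=> Kf Ny; apply: ge_inf; last by exists y.
by exists 0; exact: approx_errors_ge0.
Qed.

Let worst_errors : set R := [set t : R | exists2 f, Ksigma f & t = inf (approx_errors N Phi f)]%classic.

Lemma le_sup_approx_errors f : Ksigma f ->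
  inf (approx_errors N Phi f) <= sup worst_errors.
Proof.
move=> Kf; apply: ub_le_sup; last by exists f.
have [C hC] := lip_map_bounded N0_le1.
(* The single parameter 0 bounds all errors at once, since [Ksigma] lies in the unit ball and
   [Phi 0] is bounded. *)
exists (1 + C) => _ [h Kh ->].
apply: le_trans (inf_approx_errors_le Kh N0_le1) _.
apply: c0dist_le => i; apply: le_trans (ler_normB _ _) _.
by apply: lerD => //; exact: Ksigma_le1.
Qed.

Lemma sup_approx_errors_ge0 : 0 <= sup worst_errors.
Proof.
have K0 : @Ksigma R (fun=> 0) by left.
apply: le_trans (le_sup_approx_errors K0).
exact: lb_le_inf (approx_errors_neq0 _) (approx_errors_ge0 K0).
Qed.

Lemma sup_approx_errors_le e :
  (forall f, Ksigma f -> exists2 y, N y <= 1 & c0dist f (Phi y) <= e) ->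
  sup worst_errors <= e.
Proof.
move=> he; apply: ge_sup.
  by eexists; exists (fun=> 0); [left | ].
move=> _ [f Kf ->]; have [y Ny ye] := he _ Kf.
exact: le_trans (inf_approx_errors_le Kf Ny) ye.
Qed.

End FixedNorm.

Lemma lip_width_Y_ge0 (k : nat) (N : 'rV[R]_k -> R) (gamma : R) :
  is_norm N -> 0 < gamma -> 0 <= lip_width_Y (@Ksigma R) N gamma.
Proof.
move=> normN g0; apply: lb_le_inf.
  by eexists; exists (fun=> fun=> 0); split; first exact: lip_map_cst0.
by move=> _ [Phi [lipPhi ->]]; exact: sup_approx_errors_ge0 lipPhi.
Qed.

Lemma lip_width_le_approx (n k : nat) (N : 'rV[R]_k -> R) (gamma e : R)
    (Phi : 'rV[R]_k -> nat -> R) :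
  (1 <= k <= n)%N -> is_norm N -> 0 < gamma -> lip_map N gamma Phi ->
  (forall f, Ksigma f -> exists2 y, N y <= 1 & c0dist f (Phi y) <= e) ->
  lip_width (@Ksigma R) n gamma <= e.
Proof.
move=> kn normN g0 lipPhi he.
apply: le_trans (_ : lip_width_Y (@Ksigma R) N gamma <= _).
  apply: ge_inf; last by exists k; split=> //; exists N.
  by exists 0 => _ [k' [_ [N' [normN' ->]]]]; exact: lip_width_Y_ge0.
apply: le_trans (sup_approx_errors_le lipPhi he).
apply: ge_inf; last by exists Phi.
by exists 0 => _ [Psi [lipPsi ->]]; exact: sup_approx_errors_ge0 lipPsi.
Qed.

(** The integer [G] above [gamma] makes the grid parameter [2 M G n] a natural number; the last
    hypothesis says that the grid has fewer cells than there are peaks to separate. *)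
Lemma lip_width_Y_ge (k n M G : nat) (N : 'rV[R]_k -> R) (gamma : R) :
  is_norm N -> 0 < gamma < G%:R -> (1 <= k <= n)%N -> (0 < M)%N ->
  ((2 * M * G * n).*2.+1 ^ k < 2 ^ M.-1)%N ->
  (4 * M%:R)^-1 <= lip_width_Y (@Ksigma R) N gamma.
Proof.
move=> normN /andP[g0 gG] /andP[k1 kn] M0 count.
have MR : 0 < M%:R :> R by rewrite ltr0n.
apply: lb_le_inf.
  by eexists; exists (fun=> fun=> 0); split; first exact: lip_map_cst0.
move=> _ [Phi [lipPhi ->]].
rewrite leNgt; apply/negP => sup_lt.
have PhiB := lip_map_bounded lipPhi.
have /boolp.choice [y hy] (i : 'I_(2 ^ M.-1)) : exists y, N y <= 1 /\
    c0dist (peak R i) (Phi y) < (4 * M%:R)^-1.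
  have := le_lt_trans (le_sup_approx_errors normN lipPhi (Ksigma_peak R i)) sup_lt.
  case/inf_lt=> [|_ [z Nz ->] lt_z]; last by exists z.
  exact: approx_errors_neq0.
have : (2 ^ M.-1 <= (2 * M * G * n).*2.+1 ^ k)%N; last by rewrite leqNgt count.
have G0 : (0 < G)%N by rewrite -(ltr0n R); exact: lt_trans gG.
have n0 : (0 < n)%N := leq_trans k1 kn.
(* At coordinate [i] two peaks differ by at least [1 / M]; two errors of [1 / (4 M)] leave
   [1 / (2 M)] between the images, and the Lipschitz condition divides this by [gamma]. *)
apply: (separated_ball_card normN (delta := (2 * M%:R * gamma)^-1) (y := y)).
- by rewrite !muln_gt0 M0 G0 n0.
- rewrite ltr_pdivlMr ?mulr_gt0 // !natrM.
  have -> : k%:R * (2 * M%:R * gamma) = 2 * M%:R * (k%:R * gamma) by ring.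
  rewrite -[ltRHS]mulrA ltr_pM2l ?mulr_gt0 //.
  apply: (@le_lt_trans _ _ (n%:R * gamma)).
    by rewrite ler_pM2r // ler_nat.
  by rewrite mulrC ltr_pM2r // ltr0n.
- by move=> i; have [] := hy i.
move=> i j neq_ij; have [[yi hi] [yj hj]] := (hy i, hy j).
have bK l := Ksigma_bounded (Ksigma_peak R l).
have h1 := le_trans (c0dist_ge i (bK i) (PhiB _ yi)) (ltW hi).
have h2 := le_trans (c0dist_ge i (bK j) (PhiB _ yj)) (ltW hj).
have h3 := le_trans (c0dist_ge i (PhiB _ yi) (PhiB _ yj)) (lipPhi.2 _ _ yi yj).
have si : M%:R^-1 <= sigma_c R i.
  apply: sigma_ge; have := ltn_ord i.
  have -> : (2 ^ M = 2 * 2 ^ M.-1)%N by rewrite -expnS prednK.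
  by lia.
move: h1 h2; rewrite !peakE eqxx; have -> : (i == j :> nat) = false by apply/negbTE.
rewrite invfM => h1 h2.
rewrite invfM ler_pdivrMr // [leRHS]mulrC.
move: h1 h2 h3 si; rewrite !ler_norml => /andP[_ h1] /andP[h2 _] /andP[_ h3] si.
have -> : (2 * M%:R)^-1 = M%:R^-1 - 2 * (4^-1 * M%:R^-1) :> R.
  by field; rewrite gt_eqF.
lra.
Qed.

Lemma lip_width_ge (gamma : R) : 2 < gamma -> exists2 c : R, 0 < c <= 1 &
  forall n, (1 <= n)%N ->
    c * (1 / (n%:R * log2 n.+1%:R)) <= lip_width (@Ksigma R) n gamma.
Proof.
move=> g2.
have [G gG] : exists G : nat, gamma < G%:R.
  by exists (Num.truncn gamma).+1; exact: truncnS_gt.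
have G0 : (0 < G)%N by rewrite -(ltr0n R); lra.
(* This is [1 / (4 M)] for [M = 160 G n L], combined with [L <= 2 log2 (n + 1)]. *)
exists (8 * (160 * G)%:R)^-1.
  rewrite invr_gt0 mulr_gt0 ?ltr0n ?muln_gt0 //=.
  by rewrite invf_le1 -?natrM ?ler1n ?ltr0n ?muln_gt0.
move=> n n1; pose L := (trunc_log 2 n).+1.
have /andP[nL1 nL2] := @trunc_log_bounds 2 n isT n1.
have -> : (8 * (160 * G)%:R)^-1 * (1 / (n%:R * log2 n.+1%:R)) =
   (4 * ((160 * G)%:R * n%:R * (2 * log2 n.+1%:R)))^-1 :> R.
  by rewrite mul1r -invfM; congr (_^-1); ring.
have lg1 : 1 <= log2 n.+1%:R :> R by exact: (@log2_ge _ 1).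
have LR : L%:R <= 2 * log2 n.+1%:R :> R.
  rewrite /L -natr1.
  have : (trunc_log 2 n)%:R <= log2 n.+1%:R :> R by apply: log2_ge; exact: leqW.
  by lra.
apply: lb_le_inf.
  eexists; exists 1%N; split=> //.
  exists (fun x : 'rV[R]_1 => `|x|); split; last by [].
  split; [exact: normr0_eq0 | exact: normrZ | exact: ler_normD].
move=> _ [k [kn [N [normN ->]]]].
have M0 : (0 < 160 * G * n * L)%N by rewrite !muln_gt0 G0 n1.
apply: le_trans (lip_width_Y_ge (G := G) normN _ kn M0 _).
- move: (log2 _) lg1 LR => l l1 LR.
  have l0 : 0 < l by lra.
  rewrite lef_pV2 ?posrE; last 2 first.
  + by rewrite !mulr_gt0 ?ltr0n ?muln_gt0 ?G0.
  + by rewrite mulr_gt0 ?ltr0n.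
  by rewrite ler_pM2l // !natrM ler_wpM2l // -natrM.
- by rewrite gG andbT; lra.
- by apply: grid_count => //; case/andP: kn.
Qed.

End LipschitzWidth.

(** * Upper bound: digit encoding and bumps in the sup norm *)

Lemma digits_inj (B d i j : nat) : (i < B ^ d)%N -> (j < B ^ d)%N ->
  (forall l, (l < d)%N -> (i %/ B ^ l) %% B = (j %/ B ^ l) %% B)%N -> i = j.
Proof.
elim: d i j => [|d IHd] i j; first by rewrite expn0; lia.
move=> iB jB eq_d; have B0 : (0 < B)%N by case: B iB {eq_d jB IHd}; rewrite ?exp0n.
have := eq_d 0%N isT; rewrite expn0 !divn1 => eq_mod.
rewrite (divn_eq i B) (divn_eq j B) eq_mod; congr (_ * B + _)%N.
apply: IHd => [||l ld]; rewrite ?ltn_divLR -?expnSr //.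
by rewrite -!divnMA -expnS; apply: eq_d.
Qed.

Lemma natr_dist_ge1 (R : numDomainType) (a b : nat) : a != b -> 1 <= `|a%:R - b%:R| :> R.
Proof.
rewrite neq_ltn; wlog: a b / (a < b)%N => [h /orP[]ab|ab _].
- by apply: h; rewrite ?ab.
- by rewrite distrC; apply: h; rewrite ?ab.
by rewrite distrC -natrB 1?ltnW // normr_nat ler1n subn_gt0.
Qed.

Section SupNorm.
Variables (R : realType) (n : nat).
Implicit Types x : 'rV[R]_n.

Lemma row_norm_ge x l : `|x ord0 l| <= `|x|.
Proof.
rewrite [leRHS]mx_normrE.
exact: (le_bigmax _ (fun ij : 'I_1 * 'I_n => `|x ij.1 ij.2|) (ord0, l)).
Qed.

Lemma row_norm_le x e : 0 <= e -> (forall l, `|x ord0 l| <= e) -> `|x| <= e.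
Proof.
move=> e0 h; rewrite [leLHS]mx_normrE; apply: bigmax_le => // -[i j] _ /=.
by rewrite (ord1 i).
Qed.

Lemma is_norm_row : is_norm (fun x => `|x|).
Proof. by split; [exact: normr0_eq0 | exact: normrZ | exact: ler_normD]. Qed.

End SupNorm.

Section Construction.
Variables (R : realType) (d : nat) (gamma : R).
Hypotheses (d_gt0 : (0 < d)%N) (g2 : 2 < gamma).

Let g0 : 0 < gamma. Proof. exact: lt_trans g2. Qed.

(** Dyadic level of the weight: [2 ^ level i <= log2 (i + 2) < 2 ^ (level i + 1)], so [sigma_c i] is
    [2 ^ - level i] up to a factor 2. *)
Definition level (i : nat) : nat := trunc_log 2 (trunc_log 2 i.+2).

Let lg_gt0 i : (0 < trunc_log 2 i.+2)%N. Proof. by rewrite trunc_log_gt0. Qed.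

Lemma lt_level i : (i < 2 ^ 2 ^ (level i).+1)%N.
Proof.
have /andP[_ h1] := trunc_log_bounds (isT : 1 < 2)%N (isT : 0 < i.+2)%N.
have /andP[_ h2] := trunc_log_bounds (isT : 1 < 2)%N (lg_gt0 i).
apply: leq_trans (leq_trans h1 _); first by lia.
by rewrite leq_exp2l.
Qed.

Lemma sigma_level i : sigma_c R i <= (2 ^+ level i)^-1.
Proof.
have h1 := trunc_logP (isT : 1 < 2)%N (isT : 0 < i.+2)%N.
have h2 := trunc_logP (isT : 1 < 2)%N (lg_gt0 i).
apply: le_trans (sigma_le R (lg_gt0 i) h1) _.
by rewrite lef_pV2 ?posrE ?exprn_gt0 ?ltr0n // -natrX ler_nat.
Qed.

(* the [d] digits in base [2^(level i + 1)] determine [i] within its level *)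
Definition encodable (i : nat) : bool := (2 ^ (level i).+1 <= (level i).+1 * d)%N.

(* Coordinate 0 separates the levels, the other ones the points of one level. *)
Definition node (i : nat) : 'rV[R]_d.+1 :=
  let B := (2 ^ (level i).+1)%N in
  \row_l (if l == 0%N :> nat then (2 ^+ level i)^-1
          else ((i %/ B ^ l.-1) %% B)%N%:R / B%:R).

Lemma node_bounds i l : 0 <= node i ord0 l <= 1.
Proof.
rewrite mxE; case: ifP => _.
  by rewrite invr_ge0 exprn_ge0 //= invf_le1 ?exprn_gt0 // exprn_ege1 // ler1n.
have B0 : (0 < 2 ^ (level i).+1)%N by rewrite expn_gt0.
rewrite divr_ge0 //= ler_pdivrMr ?ltr0n // mul1r ler_nat.
by rewrite ltnW // ltn_pmod.
Qed.

Lemma node_norm i : `|node i| <= 1.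
Proof.
apply: row_norm_le => // l; have /andP[h0 h1] := node_bounds i l.
by rewrite ger0_norm.
Qed.

Lemma expV2_lt s s' : (s < s')%N -> (2 ^+ s')^-1 <= (2 ^+ s)^-1 / 2 :> R.
Proof.
move=> lt_s; rewrite -invfM -exprSr lef_pV2 ?posrE ?exprn_gt0 //.
by rewrite ler_eXn2l // ltr1n.
Qed.

(** Across levels, coordinate 0 takes distinct powers of 1/2, whose gap is at least half the larger
    one. Within level [s], some digit in base [B] differs, so some coordinate differs by at least
    [1 / B], half of [2 ^ - s]. *)
Lemma node_sep i j : encodable i -> encodable j -> i != j ->
  sigma_c R j <= 2 * `|node i - node j|.
Proof.
move=> ei ej neq_ij; apply: le_trans (sigma_level j) _.
have [eq_s|neq_s] := eqVneq (level i) (level j); last first.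
  apply: (@le_trans _ _ (2 * `|(node i - node j) ord0 ord0|)); last first.
    by rewrite ler_pM2l //; exact: row_norm_ge.
  have pos k : 0 < (2 ^+ level k)^-1 :> R by rewrite invr_gt0 exprn_gt0.
  have [pi pj] := (pos i, pos j); rewrite !mxE /=.
  move: neq_s; rewrite neq_ltn => /orP[lt_s|lt_s].
    have := expV2_lt lt_s; have := ler_norm ((2 ^+ level i)^-1 - (2 ^+ level j)^-1 : R).
    by lra.
  rewrite distrC.
  have := expV2_lt lt_s; have := ler_norm ((2 ^+ level j)^-1 - (2 ^+ level i)^-1 : R).
  by lra.
set s := level j in eq_s *; set B := (2 ^ s.+1)%N.
have B0 : 0 < B%:R :> R by rewrite ltr0n expn_gt0.
(* Encodability gives [k < 2 ^ 2 ^ (s + 1) <= 2 ^ ((s + 1) d) = B ^ d]. *)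
have lt_B k : encodable k -> level k = s -> (k < B ^ d)%N.
  rewrite /encodable => ek ks; rewrite ks in ek.
  apply: leq_trans (lt_level k) _; rewrite ks /B -expnM.
  by rewrite leq_exp2l.
have [/forallP eq_d|] := boolP [forall l : 'I_d, ((i %/ B ^ l) %% B == (j %/ B ^ l) %% B)%N].
  case/negP: neq_ij; apply/eqP; apply: (@digits_inj B d).
  - exact: lt_B.
  - exact: lt_B.
  - by move=> l ld; apply/eqP; exact: eq_d (Ordinal ld).
rewrite negb_forall => /existsP[l neq_l].
apply: (@le_trans _ _ (2 * `|(node i - node j) ord0 (lift ord0 l)|)); last first.
  by rewrite ler_pM2l //; exact: row_norm_ge.
rewrite !mxE /= eq_s -/s -/B -mulrBl normrM (gtr0_norm (x := B%:R^-1)) ?invr_gt0 // add0n.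
have -> : (2 ^+ s)^-1 = 2 * (1 / B%:R) :> R.
  by rewrite /B natrX exprS mul1r invfM mulrA mulfV ?mul1r.
rewrite ler_pM2l // ler_pM2r ?invr_gt0 //.
exact: natr_dist_ge1.
Qed.

(** Coordinates that are not encodable are set to 0: their nodes need not be separated, and their
    peaks are short enough to be approximated by 0. *)
Definition bump (y : 'rV[R]_d.+1) : nat -> R := fun i =>
  if encodable i then Num.max 0 (sigma_c R i - gamma * `|y - node i|) else 0.

Lemma bump_ge0 y i : 0 <= bump y i.
Proof. by rewrite /bump; case: ifP => // _; rewrite le_max lexx. Qed.

Lemma bump_eq0 y i : sigma_c R i <= gamma * `|y - node i| -> bump y i = 0.
Proof. by move=> h; rewrite /bump; case: ifP => // _; apply/max_idPl; rewrite subr_le0. Qed.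

Lemma bump_lip : lip_map (fun y : 'rV[R]_d.+1 => `|y|) gamma bump.
Proof.
split=> [y _|y y' _ _].
  apply: (@squeeze_cvgr _ _ _ _ (fun=> 0) (sigma_c R)); last 2 first.
  - exact: cvg_cst.
  - exact: sigma_c0.
  apply: nearW => i; rewrite bump_ge0 /= /bump; case: ifP => _; last exact/ltW/sigma_gt0.
  rewrite ge_max; apply/andP; split; first exact/ltW/sigma_gt0.
  by rewrite gerBl mulr_ge0 // ltW.
apply: c0dist_le => i; rewrite /bump; case: ifP => _; last first.
  by rewrite subrr normr0 mulr_ge0 // ltW.
have : `| gamma * `|y - node i| - gamma * `|y' - node i| | <= gamma * `|y - y'|.
  rewrite -mulrBr normrM gtr0_norm // ler_pM2l //.
  have -> : y - y' = (y - node i) - (y' - node i) by rewrite opprB addrA subrK.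
  exact: ler_dist_dist.
set u := gamma * `|y - _|; set u' := gamma * `|y' - _|; set e := gamma * `|y - y'|.
rewrite !ler_norml => /andP[h1 h2].
by case: (leP 0 (_ - u)); case: (leP 0 (_ - u')) => *; lra.
Qed.

(** Here [gamma > 2] absorbs the factor 2 of [node_sep]: at a node every other encodable bump is
    already 0. *)
Lemma bump_node i : encodable i -> bump (node i) = peak R i.
Proof.
move=> ei; apply/funext => j; rewrite peakE; case: eqP => [->|/eqP neq_ji].
  rewrite /bump ei subrr normr0 mulr0 subr0.
  by apply/max_idPr; exact/ltW/sigma_gt0.
have [ej|nej] := boolP (encodable j); last by rewrite /bump (negbTE nej).
apply: bump_eq0; rewrite eq_sym in neq_ji.
apply: le_trans (node_sep ei ej neq_ji) _.
by rewrite ler_wpM2r //; exact: ltW.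
Qed.

(** Nodes have nonnegative coordinates, so this corner is at distance at least 1 from all of them,
    while [sigma_c i <= 1 < gamma]. It serves as the parameter for 0 and for the peaks that are not
    encodable. *)
Lemma bump_corner : bump (const_mx (-1)) = fun=> 0.
Proof.
apply/funext => i; apply: bump_eq0.
have := row_norm_ge (const_mx (-1) - node i) ord0.
have /andP[n0 _] := node_bounds i ord0.
rewrite [X in `|X| <= _]mxE [X in `|X + _| <= _]mxE [X in `|_ + X| <= _]mxE => h.
have := sigma_le1 R i; have := ler_norm (node i ord0 ord0 + 1).
have -> : node i ord0 ord0 + 1 = - (-1 - node i ord0 ord0) by ring.
rewrite normrN.
set u := `|const_mx (-1) - node i| in h *.
have : 2 * u <= gamma * u by apply: ler_wpM2r; [exact: normr_ge0 | exact: ltW].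
by move: h; lra.
Qed.

(** Here [(s + 1) d < 2 ^ (s + 1)]. Then [d + 1 <= 2 ^ (s + 1)] gives [log2 (d + 2) <= 2 (s + 1)],
    and with [d + 1 <= 2 d] the product [(d + 1) log2 (d + 2)] is at most
    [4 d (s + 1) <= 8 * 2 ^ s]. *)
Lemma sigma_not_encodable i : ~~ encodable i ->
  sigma_c R i <= 8 * (1 / (d.+1%:R * log2 d.+2%:R)).
Proof.
rewrite /encodable -ltnNge; set s := level i => h.
apply: le_trans (sigma_level i) _.
have d_le : (d.+1 <= 2 ^ s.+1)%N.
  by apply: leq_trans h; rewrite ltnS leq_pmull.
have lg_le : log2 d.+2%:R <= 2 * s.+1%:R :> R.
  apply: (@le_trans _ _ s.+2%:R).
    apply: log2_le; rewrite expnS /=; lia.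
  by rewrite -natrM ler_nat; lia.
have lg1 : 1 <= log2 d.+2%:R :> R by exact: (@log2_ge _ 1).
move: (log2 _) lg1 lg_le => l l1 l_le.
have D0 : 0 < d.+1%:R :> R by rewrite ltr0n.
rewrite mul1r ler_pdivlMr ?mulr_gt0; try lra.
rewrite mulrC ler_pdivrMr ?exprn_gt0 //.
apply: (@le_trans _ _ ((2 * d%:R) * (2 * s.+1%:R))).
  apply: ler_pM => //; try lra.
  by rewrite -natrM ler_nat; lia.
have : s.+1%:R * d%:R <= 2 * 2 ^+ s :> R.
  by rewrite -exprS -natrX -natrM ler_nat ltnW.
by lra.
Qed.

Lemma lip_width_le_ge2 :
  lip_width (@Ksigma R) d.+1 gamma <= 8 * (1 / (d.+1%:R * log2 d.+2%:R)).
Proof.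
set e := 8 * _.
have e0 : 0 <= e.
  have : 1 <= log2 d.+2%:R :> R by exact: (@log2_ge _ 1).
  by move=> l1; rewrite /e mulr_ge0 // div1r invr_ge0 mulr_ge0 //; lra.
have corner_le1 : `|const_mx (-1) : 'rV[R]_d.+1| <= 1.
  by apply: row_norm_le => // l; rewrite mxE normrN1.
apply: (lip_width_le_approx (k := d.+1)) (is_norm_row R d.+1) g0 bump_lip _; first by rewrite leqnn.
move=> _ [->|[i ->]].
  exists (const_mx (-1)) => //; rewrite bump_corner.
  by apply: c0dist_le => i; rewrite subrr normr0.
rewrite -/(peak R i); have [ei|nei] := boolP (encodable i).
  exists (node i); first exact: node_norm.
  by rewrite bump_node //; apply: c0dist_le => j; rewrite subrr normr0.
exists (const_mx (-1)) => //; rewrite bump_corner.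
apply: c0dist_le => j; rewrite peakE subr0; case: eqP => _; last by rewrite normr0.
by rewrite gtr0_norm ?sigma_gt0 // sigma_not_encodable.
Qed.

End Construction.

(** * Dimension one and the two asymptotics *)

Lemma lip_width1_le (R : realType) (gamma : R) : 0 < gamma ->
  lip_width (@Ksigma R) 1 gamma <= 1.
Proof.
move=> g0; have normN := is_norm_row R 1.
apply: (lip_width_le_approx (k := 1%N)) normN g0 (lip_map_cst0 normN g0) _ => // f Kf.
exists 0; first by rewrite normr0.
by apply: c0dist_le => i; rewrite subr0; exact: Ksigma_le1.
Qed.

Theorem theorem4p10 (R : realType) :
  asymp (fun n => inner_entropy (@Ksigma R) n) (fun n => 1 / n%:R) /\
  (forall gamma : R, 2 < gamma ->
     asymp (fun n => lip_width (@Ksigma R) n gamma)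
           (fun n => 1 / (n%:R * log2 (n.+1)%:R))).
Proof.
split=> [|gamma g2].
  exists 2^-1, 1; split; [lra | split; [lra | move=> n n1]].
  by split; [exact: inner_entropy_ge | rewrite [leRHS]mul1r; exact: inner_entropy_le].
have [c /andP[c0 c1] hc] := lip_width_ge g2.
exists c, 8; split=> //; split; first lra.
(* The construction uses [d + 1] coordinates with [d > 0], so [n = 1] is separate: there
   [log2 2 = 1] and the trivial error 1 is below 8. *)
move=> [|[|n]] // n1; split; [exact: hc | | exact: hc | exact: lip_width_le_ge2].
apply: le_trans (lip_width1_le _) _; first lra.
by rewrite (log2_exp R 1) mul1r; lra.
Qed.
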